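(* Let $n$ be a positive integer, let $R$ be a ring and let $M$ be a faithful left $R$-module. Then $\Delta(M)$ is a faithful left $MC_n(R)$-module.
   Context: All rings are associative with $1$; modules are left unitary modules. $M_m(R)$ is the ring of $m\times m$ matrices over $R$. Fix $n\ge 1$ and identify $M_n(M_{n^k}(R))$ with $M_{n^{k+1}}(R)$ via block matrices. The $n$-matricial closure $MC_n(R)$ is the direct limit of the rings $M_{n^k}(R)$, $k\in\mathbb{N}=\{0,1,2,\dots\}$ (with $M_{n^0}(R)=R$), along the injective ring morphisms $M_{n^k}(R)\to M_{n^{k+1}}(R)$ sending $A$ to the block diagonal matrix with $n$ diagonal blocks equal to $A$. For a left $R$-module $M$, $\delta_k(M)=M^{n^k}$ is the left $M_{n^k}(R)$-module of column vectors, with the usual action $(A\varphi)(r)=\sum_{s}A_{rs}\varphi(s)$ for $A\in M_{n^k}(R)$, $\varphi\in M^{n^k}$. Identifying $M^{n^{k+1}}=(M^{n^k})^n$ compatibly with the block identification of matrices, the connecting maps are the diagonal maps $M^{n^k}\to M^{n^{k+1}}$, $v\mapsto(v,\dots,v)$, which are compatible with the ring maps $M_{n^k}(R)\to M_{n^{k+1}}(R)$. $\Delta(M)=\varinjlim_k \delta_k(M)$ is the direct limit, with its induced structure of left $MC_n(R)$-module. *)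

(* Defs.v *)
From HB Require Import structures.
From mathcomp Require Import all_boot all_order all_algebra.
From mathcomp Require Import boolp zify.

Set Implicit Arguments.
Unset Strict Implicit.
Unset Printing Implicit Defensive.

Import Order.TTheory GRing.Theory.
Local Open Scope ring_scope.
Local Open Scope quotient_scope.

Definition faithful_module (R : pzRingType) (M : lmodType R) : Prop :=
  forall a : R, (forall x : M, a *: x = 0) -> a = 0.

Section DirectLimit.
Variables (A : nat -> choiceType) (f : forall k, A k -> A k.+1).

Definition dl_next (u : {k & A k}) : {k & A k} := Tagged A (f (tagged u)).

(* Two elements are identified when they have a common image further along the
   sequence: equality in {k & A k} includes equality of levels. Classical logic
   (boolp) only serves to make this a boolean relation. *)
Definition dl_equiv (u v : {k & A k}) : bool :=
  `[< exists a b, iter a dl_next u = iter b dl_next v >].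

Fact dl_equiv_refl : reflexive dl_equiv.
Proof. by move=> u; apply/asboolP; exists 0%N, 0%N. Qed.

Fact dl_equiv_sym : symmetric dl_equiv.
Proof.
by move=> u v; apply/asboolP/asboolP => -[a [b e]]; exists b, a; rewrite e.
Qed.

Fact dl_equiv_trans : transitive dl_equiv.
Proof.
move=> v u w /asboolP[a [b e]] /asboolP[c [d e']]; apply/asboolP.
by exists (c + a)%N, (b + d)%N; rewrite !iterD e -e' -!iterD addnC.
Qed.

Canonical dl_equiv_rel :=
  EquivRel dl_equiv dl_equiv_refl dl_equiv_sym dl_equiv_trans.

Definition dlim := {eq_quot dl_equiv_rel}.
HB.instance Definition _ := Choice.on dlim.

Definition dl_in k (x : A k) : dlim := \pi_dlim (Tagged A x).

Fixpoint dl_push m k (x : A k) : A (m + k) :=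
  if m is m'.+1 then f (dl_push m' x) else x.

Lemma iter_dl_next m k (x : A k) :
  iter m dl_next (Tagged A x) = Tagged A (dl_push m x).
Proof. by elim: m => //= m ->. Qed.

Lemma dl_in_eqP i j (x : A i) (y : A j) :
  dl_in x = dl_in y <->
  exists a b, Tagged A (dl_push a x) = Tagged A (dl_push b y).
Proof.
split=> [/eqmodP/asboolP[a [b e]]|[a [b e]]].
  by exists a, b; rewrite -!iter_dl_next.
by apply/eqmodP/asboolP; exists a, b; rewrite !iter_dl_next.
Qed.

Lemma dl_in_next k (x : A k) : dl_in (f x) = dl_in x.
Proof. by apply/dl_in_eqP; exists 0%N, 1%N. Qed.

Lemma dl_in_push m k (x : A k) : dl_in (dl_push m x) = dl_in x.
Proof. by elim: m => //= m <-; rewrite dl_in_next. Qed.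

Lemma dl_in_cast i j (e : i = j) (x : A i) : dl_in (ecast k (A k) e x) = dl_in x.
Proof. by case: _ / e. Qed.

Lemma dl_repr (u : dlim) : dl_in (tagged (repr u)) = u.
Proof. by rewrite /dl_in -[RHS]reprK; case: (repr u). Qed.

Lemma dl_surj (u : dlim) : exists k (x : A k), u = dl_in x.
Proof. by exists (tag (repr u)), (tagged (repr u)); rewrite dl_repr. Qed.

Lemma dl_in_lift i (x : A i) j : (i <= j)%N ->
  exists y : A j, dl_in x = dl_in y.
Proof.
move=> le_ij; exists (ecast k (A k) (subnK le_ij) (dl_push (j - i) x)).
by rewrite dl_in_cast dl_in_push.
Qed.

End DirectLimit.

(* Both arguments are pushed to level j + i before applying op. *)

Section DirectLimitOp.
Variables (A B C : nat -> choiceType).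
Variables (f : forall k, A k -> A k.+1) (g : forall k, B k -> B k.+1).
Variables (h : forall k, C k -> C k.+1).
Variable op : forall k, A k -> B k -> C k.

Definition dl_op (u : dlim f) (v : dlim g) : dlim h :=
  let: existT i x := repr u in
  let: existT j y := repr v in
  dl_in h (op (dl_push f j x)
              (ecast k (B k) (addnC i j) (dl_push g i y))).

Hypothesis opP : forall k x y, h (op x y) = op (f x) (g y) :> C k.+1.

Lemma dl_op_wd k l (x : A k) (y : B k) (x' : A l) (y' : B l) :
    dl_in f x = dl_in f x' -> dl_in g y = dl_in g y' ->
  dl_in h (op x y) = dl_in h (op x' y').
Proof.
have pushP m i (a : A i) (b : B i) :
    dl_push h m (op a b) = op (dl_push f m a) (dl_push g m b).
  by elim: m => //= m ->; rewrite opP.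
have opT i j (a : A i) (b : B i) (a' : A j) (b' : B j) :
    Tagged A a = Tagged A a' -> Tagged B b = Tagged B b' ->
    Tagged C (op a b) = Tagged C (op a' b').
  move=> e; have eij : i = j := congr1 tag e.
  case: _ / eij in a' b' e *; have {e} -> := eq_from_Tagged e.
  by move=> e; have {e} -> := eq_from_Tagged e.
have shift (D : nat -> choiceType) (t : forall i, D i -> D i.+1)
    (a b c d : nat) (z : D k) (z' : D l) : (a + k = b + l)%N ->
    iter c (dl_next t) (Tagged D z) = iter d (dl_next t) (Tagged D z') ->
    iter (a + c) (dl_next t) (Tagged D z)
      = iter (b + c) (dl_next t) (Tagged D z').
  move=> eab e; have : (c + k = d + l)%N.
    by have := congr1 tag e; rewrite !iter_dl_next.
  move=> ecd; rewrite iterD e -iterD; congr iter.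
  by apply: (@addIn l); lia.
move=> /dl_in_eqP[a [b e]] /dl_in_eqP[c [d e']].
have eab : (a + k = b + l)%N := congr1 tag e.
rewrite -!iter_dl_next in e e'.
have e1 := shift _ _ _ _ _ _ _ _ eab e'.
have e2 : iter (a + c) (dl_next f) (Tagged A x) =
          iter (b + c) (dl_next f) (Tagged A x').
  by rewrite ![(_ + c)%N]addnC !iterD e.
apply/dl_in_eqP; exists (a + c)%N, (b + c)%N.
by rewrite !pushP; apply: opT; rewrite -!iter_dl_next.
Qed.

Lemma dl_opE k (x : A k) (y : B k) :
  dl_op (dl_in f x) (dl_in g y) = dl_in h (op x y).
Proof.
rewrite /dl_op; have := dl_repr (dl_in f x); have := dl_repr (dl_in g y).
case: (repr _) (repr _) => [i x'] [j y'] /= ey ex.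
by apply: dl_op_wd; rewrite ?dl_in_cast dl_in_push.
Qed.

End DirectLimitOp.

Lemma dl_surj2 (A B : nat -> choiceType) (f : forall k, A k -> A k.+1)
    (g : forall k, B k -> B k.+1) (u : dlim f) (v : dlim g) :
  exists k (x : A k) (y : B k), u = dl_in f x /\ v = dl_in g y.
Proof.
have [[i [x ->]] [j [y ->]]] := (dl_surj u, dl_surj v).
have [x' ->] := dl_in_lift f x (leq_addr j i).
have [y' ->] := dl_in_lift g y (leq_addl i j).
by exists (i + j)%N, x', y'.
Qed.

Lemma dl_surj3 (A B C : nat -> choiceType) (f : forall k, A k -> A k.+1)
    (g : forall k, B k -> B k.+1) (h : forall k, C k -> C k.+1)
    (u : dlim f) (v : dlim g) (w : dlim h) :
  exists k (x : A k) (y : B k) (z : C k),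
    [/\ u = dl_in f x, v = dl_in g y & w = dl_in h z].
Proof.
have [i [x [y [-> ->]]]] := dl_surj2 u v; have [j [z ->]] := dl_surj w.
have [x' ->] := dl_in_lift f x (leq_addr j i).
have [y' ->] := dl_in_lift g y (leq_addr j i).
have [z' ->] := dl_in_lift h z (leq_addl i j).
by exists (i + j)%N, x', y', z'.
Qed.

Section ZmodLimit.
Variables (A : nat -> zmodType) (f : forall k, {additive A k -> A k.+1}).

Definition zmod_lim := dlim (A := A) f.
HB.instance Definition _ := Choice.on zmod_lim.

Definition zl_in k (x : A k) : zmod_lim := dl_in (A := A) f x.

Definition zl_add (u v : zmod_lim) : zmod_lim :=
  dl_op (C := A) f (fun k => +%R) u v.
Definition zl_opp (u : zmod_lim) : zmod_lim := zl_in (- tagged (repr u)).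

Lemma zl_addE k (x y : A k) : zl_add (zl_in x) (zl_in y) = zl_in (x + y).
Proof. by apply: dl_opE => i a b; rewrite raddfD. Qed.

Lemma zl_in0 i j : zl_in (0 : A i) = zl_in (0 : A j).
Proof.
have z0 k : zl_in (0 : A k) = zl_in (0 : A 0).
  elim: k => // k <-; rewrite -(raddf0 (f k)).
  exact: (dl_in_next (A := A)).
by rewrite !z0.
Qed.

Lemma zl_oppE k (x : A k) : zl_opp (zl_in x) = zl_in (- x).
Proof.
have := dl_repr (zl_in x); rewrite /zl_opp.
case: (repr _) => i y /= e.
have opN l (_ z : A l) : f l (- z) = - f l z by rewrite raddfN.
exact: (@dl_op_wd A A A f f f (fun l (_ z : A l) => - z) opN _ _ y y x x e e).
Qed.

Fact zl_addA : associative zl_add.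
Proof.
move=> u v w; have [k [x [y [z [-> -> ->]]]]] := dl_surj3 u v w.
by rewrite !zl_addE addrA.
Qed.

Fact zl_addC : commutative zl_add.
Proof.
move=> u v; have [k [x [y [-> ->]]]] := dl_surj2 u v.
by rewrite !zl_addE addrC.
Qed.

Fact zl_add0 : left_id (zl_in (0 : A 0)) zl_add.
Proof.
move=> u; have [k [x ->]] := dl_surj u.
by rewrite (zl_in0 0 k) zl_addE add0r.
Qed.

Fact zl_addN : left_inverse (zl_in (0 : A 0)) zl_opp zl_add.
Proof.
move=> u; have [k [x ->]] := dl_surj u.
by rewrite zl_oppE zl_addE addNr; apply: zl_in0.
Qed.

HB.instance Definition _ :=
  GRing.isZmodule.Build zmod_lim zl_addA zl_addC zl_add0 zl_addN.

Fact zl_in_is_zmod_morphism k : zmod_morphism (@zl_in k).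
Proof. by move=> x y; rewrite -zl_addE -zl_oppE. Qed.
HB.instance Definition _ k :=
  GRing.isZmodMorphism.Build (A k) zmod_lim (@zl_in k) (@zl_in_is_zmod_morphism k).

End ZmodLimit.

Section RingLimit.
Variables (A : nat -> pzRingType) (f : forall k, {rmorphism A k -> A k.+1}).

Definition ring_lim := zmod_lim (A := A) f.
HB.instance Definition _ := GRing.Zmodule.on ring_lim.

Definition rl_in k (x : A k) : ring_lim := zl_in (A := A) f x.

Definition rl_mul (u v : ring_lim) : ring_lim :=
  dl_op (A := A) (B := A) (C := A) f (fun k => *%R) u v.

Lemma rl_mulE k (x y : A k) : rl_mul (rl_in x) (rl_in y) = rl_in (x * y).
Proof. by apply: dl_opE => i a b; apply: (rmorphM (f i)). Qed.

Lemma rl_in1 k : rl_in (1 : A k) = rl_in (1 : A 0).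
Proof.
elim: k => // k <-; rewrite -(rmorph1 (f k)).
exact: (dl_in_next (A := A)).
Qed.

Lemma rl_inD k (x y : A k) : rl_in (x + y) = rl_in x + rl_in y.
Proof. exact: (raddfD (@zl_in A f k)). Qed.

Fact rl_mulA : associative rl_mul.
Proof.
move=> u v w; have [k [x [y [z [-> -> ->]]]]] := dl_surj3 u v w.
by rewrite !rl_mulE mulrA.
Qed.

Fact rl_mul1l : left_id (rl_in (1 : A 0)) rl_mul.
Proof.
move=> u; have [k [x ->]] := dl_surj u.
by rewrite -(rl_in1 k) rl_mulE mul1r.
Qed.

Fact rl_mul1r : right_id (rl_in (1 : A 0)) rl_mul.
Proof.
move=> u; have [k [x ->]] := dl_surj u.
by rewrite -(rl_in1 k) rl_mulE mulr1.
Qed.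

Fact rl_mulDl : left_distributive rl_mul +%R.
Proof.
move=> u v w; have [k [x [y [z [-> -> ->]]]]] := dl_surj3 u v w.
by rewrite -rl_inD !rl_mulE mulrDl rl_inD.
Qed.

Fact rl_mulDr : right_distributive rl_mul +%R.
Proof.
move=> u v w; have [k [x [y [z [-> -> ->]]]]] := dl_surj3 u v w.
by rewrite -rl_inD !rl_mulE mulrDr rl_inD.
Qed.

HB.instance Definition _ := GRing.Zmodule_isPzRing.Build ring_lim
  rl_mulA rl_mul1l rl_mul1r rl_mulDl rl_mulDr.

Fact rl_in_is_zmod_morphism k : zmod_morphism (@rl_in k).
Proof. exact: raddfB. Qed.
HB.instance Definition _ k := GRing.isZmodMorphism.Build (A k) ring_lim
  (@rl_in k) (@rl_in_is_zmod_morphism k).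

Fact rl_in_is_monoid_morphism k : monoid_morphism (@rl_in k).
Proof. by split=> [|x y]; [exact: rl_in1 | rewrite -rl_mulE]. Qed.
HB.instance Definition _ k := GRing.isMonoidMorphism.Build (A k) ring_lim
  (@rl_in k) (@rl_in_is_monoid_morphism k).

End RingLimit.

(* g k is additive with g k (a *: v) = f k a *: g k v. *)

Section ModLimit.
Variables (A : nat -> pzRingType) (f : forall k, {rmorphism A k -> A k.+1}).
Variables (V : forall k, lmodType (A k)).
Variable g : forall k, {linear V k -> V k.+1 | f k \; *:%R}.

Definition mod_lim := zmod_lim (A := V) g.
HB.instance Definition _ := GRing.Zmodule.on mod_lim.

Definition ml_in k (v : V k) : mod_lim := zl_in (A := V) g v.

Definition ml_scale (a : ring_lim f) (v : mod_lim) : mod_lim :=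
  dl_op (A := A) (B := V) (C := V) g (fun k => *:%R) a v.

Lemma ml_scaleE k (a : A k) (v : V k) :
  ml_scale (rl_in f a) (ml_in v) = ml_in (a *: v).
Proof. by apply: dl_opE => i b w; apply: (linearZ_LR (g i)). Qed.

Lemma ml_inD k (v w : V k) : ml_in (v + w) = ml_in v + ml_in w.
Proof. exact: (raddfD (@zl_in V g k)). Qed.

Fact ml_scaleA a b v : ml_scale a (ml_scale b v) = ml_scale (a * b) v.
Proof.
have [k [x [y [z [-> -> ->]]]]] := dl_surj3 a b v.
by rewrite -(rmorphM (@rl_in A f k)) !ml_scaleE scalerA.
Qed.

Fact ml_scale1 : left_id 1 ml_scale.
Proof.
move=> v; have [k [x ->]] := dl_surj v.
by rewrite -(rmorph1 (@rl_in A f k)) ml_scaleE scale1r.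
Qed.

Fact ml_scaleDr : right_distributive ml_scale +%R.
Proof.
move=> a v w; have [k [x [y [z [-> -> ->]]]]] := dl_surj3 a v w.
by rewrite -ml_inD !ml_scaleE scalerDr ml_inD.
Qed.

Fact ml_scaleDl v : {morph ml_scale^~ v : a b / a + b}.
Proof.
move=> a b; have [k [x [y [z [-> -> ->]]]]] := dl_surj3 a b v.
by rewrite -(rmorphD (@rl_in A f k)) !ml_scaleE scalerDl ml_inD.
Qed.

HB.instance Definition _ := GRing.Zmodule_isLmodule.Build (ring_lim f) mod_lim
  ml_scaleA ml_scale1 ml_scaleDr ml_scaleDl.

Lemma ml_inZ k (a : A k) (v : V k) : ml_in (a *: v) = rl_in f a *: ml_in v.
Proof. by rewrite -ml_scaleE. Qed.

End ModLimit.

Definition colmod (R : pzRingType) (M : lmodType R) (m : nat) := 'cV[M]_m.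

Section ColumnModule.
Variables (R : pzRingType) (M : lmodType R) (m : nat).

HB.instance Definition _ := GRing.Zmodule.on (colmod M m).

Definition colmod_scale (A : 'M[R]_m) (v : colmod M m) : colmod M m :=
  \col_r \sum_s A r s *: v s 0.

Fact colmod_scaleA A B v :
  colmod_scale A (colmod_scale B v) = colmod_scale (A * B) v.
Proof.
apply/colP => r; rewrite !mxE.
under eq_bigr do rewrite mxE scaler_sumr.
under [RHS]eq_bigr do rewrite mxE scaler_suml.
rewrite exchange_big; apply: eq_bigr => s _; apply: eq_bigr => t _.
by rewrite scalerA.
Qed.

Fact colmod_scale1 : left_id 1 colmod_scale.
Proof.
move=> v; apply/colP => r; rewrite mxE (bigD1 r) //= big1 => [|s ne].
  by rewrite mxE eqxx scale1r addr0.
by rewrite mxE eq_sym (negbTE ne) scale0r.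
Qed.

Fact colmod_scaleDr : right_distributive colmod_scale +%R.
Proof.
move=> A v w; apply/colP => r; rewrite !mxE -big_split.
by apply: eq_bigr => s _; rewrite mxE scalerDr.
Qed.

Fact colmod_scaleDl v : {morph colmod_scale^~ v : A B / A + B}.
Proof.
move=> A B; apply/colP => r; rewrite !mxE -big_split.
by apply: eq_bigr => s _; rewrite mxE scalerDl.
Qed.

HB.instance Definition _ := GRing.Zmodule_isLmodule.Build 'M[R]_m (colmod M m)
  colmod_scaleA colmod_scale1 colmod_scaleDr colmod_scaleDl.

End ColumnModule.

(* \mxdiag and \mxcol index the rows by the same bijection between
   'I_(\sum_(i < n) m) and pairs (block, position in the block). *)

Section Blocks.
Variables (n m m' : nat) (e : (\sum_(i < n) m)%N = m').

Definition diag_block (R : pzRingType) (A : 'M[R]_m) : 'M[R]_m' :=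
  castmx (e, e) (\mxdiag_(i < n) A).

Definition col_block (T : Type) (v : 'cV[T]_m) : 'cV[T]_m' :=
  castmx (e, erefl) (\mxcol_(i < n) v).

Lemma diag_blockB (R : pzRingType) : zmod_morphism (@diag_block R).
Proof.
by move=> A B; rewrite /diag_block mxdiagB; case: _ / e; rewrite !castmx_id.
Qed.

Lemma diag_block_monoid (R : pzRingType) : monoid_morphism (@diag_block R).
Proof.
rewrite /diag_block; case: _ / e; split=> [|A B]; rewrite !castmx_id.
  exact: mxdiagZ.
rewrite -[LHS]/(\mxdiag_(i < n) (A *m B)) -[RHS]/(_ *m _).
rewrite [X in _ = _ *m X]/mxdiag mul_mxdiag_mxblock.
apply/eq_mxblock => i j; case: eqP => _; last by rewrite mulmx0.
by rewrite !conform_mx_id.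
Qed.

Lemma col_blockD (V : zmodType) : {morph @col_block V : v w / v + w}.
Proof.
by move=> v w; rewrite /col_block mxcolD; case: _ / e; rewrite !castmx_id.
Qed.

Lemma col_blockZ (R : pzRingType) (M : lmodType R) (A : 'M[R]_m)
    (v : colmod M m) :
  col_block (A *: v : colmod M m) =
    diag_block A *: (col_block v : colmod M m') :> colmod M m'.
Proof.
rewrite /col_block /diag_block; case: _ / e; rewrite !castmx_id.
apply/colP => r; rewrite [RHS]mxE !mxE.
under [RHS]eq_bigr do rewrite !mxE.
pose F i (t : 'I_m) :=
  (if tagnat.sig1 r == i then A else 0) (tagnat.sig2 r) t *: v t 0.
transitivity (\sum_(i < n) \sum_(t < m) F i t).
  rewrite (bigD1 (tagnat.sig1 r)) //= [X in _ + X]big1 ?addr0 => [|i ne].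
    by apply: eq_bigr => t _; rewrite /F eqxx.
  by apply: big1 => t _; rewrite /F eq_sym (negbTE ne) mxE scale0r.
rewrite sig_big_dep/= (reindex _ tagnat.sig_bij_on)/=.
by apply: eq_bigr => s _; rewrite /F conform_mx_id.
Qed.

End Blocks.

Fact sum_expn n k : (\sum_(i < n) n ^ k = n ^ k.+1)%N.
Proof. by rewrite sum_nat_const card_ord expnS. Qed.

Section MatricialClosure.
Variables (n : nat) (R : pzRingType).

Definition mc_map k (A : 'M[R]_(n ^ k)) : 'M[R]_(n ^ k.+1) :=
  diag_block (sum_expn n k) A.

HB.instance Definition _ k := GRing.isZmodMorphism.Build
  'M[R]_(n ^ k) 'M[R]_(n ^ k.+1) (@mc_map k)
  (@diag_blockB _ _ _ (sum_expn n k) R).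
HB.instance Definition _ k := GRing.isMonoidMorphism.Build
  'M[R]_(n ^ k) 'M[R]_(n ^ k.+1) (@mc_map k)
  (@diag_block_monoid _ _ _ (sum_expn n k) R).

Definition MC : pzRingType :=
  ring_lim (A := fun k => 'M[R]_(n ^ k)) (fun k => @mc_map k).

Definition MC_in k (A : 'M[R]_(n ^ k)) : MC :=
  rl_in (A := fun k => 'M[R]_(n ^ k)) (fun k => @mc_map k) A.
HB.instance Definition _ k := GRing.isZmodMorphism.Build
  'M[R]_(n ^ k) MC (@MC_in k)
  (@rl_in_is_zmod_morphism (fun k => 'M[R]_(n ^ k)) (fun k => @mc_map k) k).
HB.instance Definition _ k := GRing.isMonoidMorphism.Build
  'M[R]_(n ^ k) MC (@MC_in k)
  (@rl_in_is_monoid_morphism (fun k => 'M[R]_(n ^ k)) (fun k => @mc_map k) k).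

Lemma MC_surj (a : MC) : exists k (A : 'M[R]_(n ^ k)), a = MC_in A.
Proof. exact: dl_surj. Qed.

Lemma MC_in_map k (A : 'M[R]_(n ^ k)) : MC_in (mc_map A) = MC_in A.
Proof. exact: dl_in_next. Qed.

Variable M : lmodType R.

Definition delta (k : nat) : lmodType 'M[R]_(n ^ k) := colmod M (n ^ k).

Definition delta_map k (v : delta k) : delta k.+1 :=
  col_block (sum_expn n k) v.

Fact delta_map_is_linear k :
  linear_for (@mc_map k \; *:%R) (@delta_map k).
Proof.
move=> a v w; rewrite /delta_map.
rewrite -[LHS]/(col_block _ ((a *: v : colmod M _) + (w : colmod M _))).
by rewrite col_blockD col_blockZ.
Qed.
HB.instance Definition _ k := GRing.isLinear.Build
  'M[R]_(n ^ k) (delta k) (delta k.+1) (@mc_map k \; *:%R) (@delta_map k)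
  (@delta_map_is_linear k).

Definition Delta : lmodType MC :=
  mod_lim (A := fun k => 'M[R]_(n ^ k)) (f := fun k => @mc_map k) (V := delta)
    (fun k => @delta_map k).

Definition Delta_in k (v : delta k) : Delta :=
  ml_in (V := delta) (fun k => @delta_map k) v.
HB.instance Definition _ k := GRing.isZmodMorphism.Build
  (delta k) Delta (@Delta_in k)
  (@zl_in_is_zmod_morphism delta (fun k => @delta_map k) k).

Lemma Delta_surj (u : Delta) : exists k (v : delta k), u = Delta_in v.
Proof. exact: dl_surj. Qed.

Lemma Delta_in_map k (v : delta k) : Delta_in (delta_map v) = Delta_in v.
Proof. exact: dl_in_next. Qed.

Lemma Delta_in_eqP i j (v : delta i) (w : delta j) :
  Delta_in v = Delta_in w <->
  exists a b, Tagged delta (dl_push (A := delta) (fun k => @delta_map k) a v) =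
              Tagged delta (dl_push (A := delta) (fun k => @delta_map k) b w).
Proof. exact: dl_in_eqP. Qed.

Lemma Delta_inZ k (A : 'M[R]_(n ^ k)) (v : delta k) :
  Delta_in (A *: v) = MC_in A *: Delta_in v.
Proof. exact: ml_inZ. Qed.

End MatricialClosure.

(* Main.v *)
Require Import Defs.
From mathcomp Require Import all_boot all_order all_algebra.

(* Since n > 0, the connecting maps of Delta(M) are injective, so each
   M^(n^k) embeds in Delta(M). A matrix annihilating Delta(M) therefore
   annihilates every column with a single nonzero entry x, which says that each
   of its entries annihilates M. *)

Set Implicit Arguments.
Unset Strict Implicit.
Unset Printing Implicit Defensive.

Import GRing.Theory.
Local Open Scope ring_scope.

(** The block of index 0 gives back the original column; it exists because [n] is positive. *)
Lemma col_block_inj (n m m' : nat) (e : (\sum_(i < n) m)%N = m') (T : Type) :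
  (0 < n)%N -> injective (@col_block n m m' e T).
Proof.
move=> n_gt0 v w; rewrite /col_block; case: _ / e; rewrite !castmx_id.
by move=> /eq_mxcolP /(_ (Ordinal n_gt0)).
Qed.

Lemma dl_push_inj (A : nat -> choiceType) (f : forall k, A k -> A k.+1) m k :
  (forall i, injective (f i)) -> injective (@dl_push A f m k).
Proof. by move=> f_inj; elim: m => //= m IHm x y /f_inj /IHm. Qed.

Lemma dl_in_inj (A : nat -> choiceType) (f : forall k, A k -> A k.+1) k :
  (forall i, injective (f i)) -> injective (@dl_in A f k).
Proof.
move=> f_inj x y /dl_in_eqP[a [b e]].
(* Tagged equality includes equality of levels, so both elements, starting at level [k], have been
   pushed the same number of times. *)
have /addIn eab : (a + k = b + k)%N := congr1 tag e.
by case: _ / eab e => e; apply: dl_push_inj f_inj _ _ (eq_from_Tagged e).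
Qed.

Lemma Delta_in_inj (n : nat) (R : pzRingType) (M : lmodType R) k :
  (0 < n)%N -> injective (@Delta_in n R M k).
Proof.
move=> n_gt0; apply: (@dl_in_inj (delta n M) (@delta_map n R M) k) => i.
exact: col_block_inj.
Qed.

Lemma faithful_colmod (R : pzRingType) (M : lmodType R) (m : nat) :
  faithful_module M -> @faithful_module 'M[R]_m (colmod M m).
Proof.
move=> M_faithful A A0; apply/matrixP => r s; rewrite mxE.
apply: M_faithful => x.
pose v : colmod M m := \col_t (if t == s then x else 0).
(* Only the summand at [s] survives in row [r] of [A *: v], leaving [A r s *: x = 0]. *)
have /colP /(_ r) := A0 v; rewrite !mxE (bigD1 s) //= big1 => [|t /negbTE ne].
  by rewrite mxE eqxx addr0.
by rewrite mxE ne scaler0.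
Qed.

Theorem proposition16 (n : nat) (n_gt0 : (0 < n)%N) (R : pzRingType)
    (M : lmodType R) (M_faithful : faithful_module M) :
  @faithful_module (MC n R) (Delta n M).
Proof.
move=> a; have [k [A ->]] := MC_surj a => A0.
rewrite (_ : A = 0) ?raddf0 //; apply: (faithful_colmod M_faithful) => v.
(* [A *: v = 0] is tested in the limit, where its left side becomes [MC_in A *: Delta_in v], zero by
   [A0]. *)
by apply: (Delta_in_inj (k := k) n_gt0); rewrite (Delta_inZ A v) A0 raddf0.
Qed.
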